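(* Let $\varepsilon \in (0,1)$, $q > 0$, $\sigma>0$, and $1/2 < \alpha < (1+\varepsilon)^{-1}$. Assume that: (i) for every sequence $(y_n)_{n\ge 1}$ of positive reals such that $N_n^{\alpha \varepsilon} \preccurlyeq y_n \preccurlyeq N_n^\alpha$, one has $\log \mathbb{P}(Y_n \geqslant y_n) \sim -q\, y_n^{1-\varepsilon}$ as $n\to\infty$; (ii) $\mathbb{E}[Y_n^2] \to \sigma^2$ as $n\to\infty$; (iii) there exists $\gamma \in (0,1]$ such that $\mathbb{E}[|Y_n|^{2+\gamma}] = o(N_n^{\gamma(1-\alpha)})$ as $n\to\infty$. Then, for all $y \geqslant 0$, $$\lim_{n \to \infty} \frac{1}{N_n^{2\alpha-1}} \log \mathbb{P}(T_n \geqslant N_n^{\alpha} y) = - \frac{y^2}{2\sigma^2}.$$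
   Context: For each $n \geqslant 1$, $Y_n$ is a centered real-valued random variable (i.e. integrable with mean $0$), $N_n\ge 1$ is a natural number with $N_n\to\infty$ as $n\to\infty$, and $(Y_{n,i})_{1\le i\le N_n}$ is a family of i.i.d. random variables distributed as $Y_n$. Set $T_n = \sum_{i=1}^{N_n} Y_{n,i}$. The notation $x_n \preccurlyeq y_n$ means $\limsup_{n\to\infty} |x_n/y_n| < \infty$, and $a_n\sim b_n$ means $a_n/b_n\to 1$. *)

(* Defs.v *)
From mathcomp Require Import all_boot all_order all_algebra.
From mathcomp Require Import all_classical all_reals all_analysis.
Set Implicit Arguments.
Unset Strict Implicit.
Unset Printing Implicit Defensive.
Import Order.TTheory GRing.Theory Num.Theory.
Import numFieldNormedType.Exports.
Local Open Scope classical_set_scope.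
Local Open Scope ring_scope.
Local Open Scope ereal_scope.

Section asymptotic_comparison.
Context {R : realType}.

Definition asymp_dominated (x y : nat -> R) : Prop :=
  limn_esup (fun n => (`|x n / y n|%R)%:E) < +oo.

(* The left-hand sequences below are extended-real so that log 0 = -oo and
   infinite moments are represented faithfully. The comparison sequence b is
   meant to be nonzero for all large n. *)
Definition asymp_equiv (a : nat -> \bar R) (b : nat -> R) : Prop :=
  a n * ((b n)^-1)%:E @[n --> \oo] --> 1.

Definition asymp_negligible (a : nat -> \bar R) (b : nat -> R) : Prop :=
  a n * ((b n)^-1)%:E @[n --> \oo] --> 0.

End asymptotic_comparison.

Section random_variables.
Context {d : measure_display} {T : measurableType d} {R : realType}.
Variable P : probability T R.

Definition mutually_independent (I : finType) (X : I -> {RV P >-> R}) : Prop :=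
  forall (J : {set I}) (A : I -> set R), (forall i, measurable (A i)) ->
    P (\bigcap_(i in [set` J]) (X i @^-1` A i)) =
    \prod_(i in J) P (X i @^-1` A i).

Definition same_distribution (X Y : {RV P >-> R}) : Prop :=
  forall A : set R, measurable A -> distribution P X A = distribution P Y A.

Definition iid_copies (I : finType) (X : I -> {RV P >-> R})
    (Y : {RV P >-> R}) : Prop :=
  mutually_independent X /\ forall i, same_distribution (X i) Y.

Definition centered (Y : {RV P >-> R}) : Prop :=
  P.-integrable [set: T] (EFin \o Y) /\ 'E_P[Y] = 0.

End random_variables.

(* Main.v *)
(* Truncating each summand at N^alpha, set
   G_n(l) = E[exp(l Y_n); Y_n < N^alpha].  For l = t N^(alpha-1) one shows
   G_n(l) = 1 + l^2 (sigma^2/2 + o(1)): below N^(1-alpha) a second order Taylor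
   expansion of exp has an error controlled by (iii); between N^(1-alpha) and
   N^alpha, a grid of finitely many intermediate powers of N and the tail
   estimate (i) show that the contribution is o(l^2), because
   l u = o(u^(1-eps)) for u <= N^alpha when alpha (1 + eps) < 1.
   Hence G_n(l)^N = exp(N^(2 alpha - 1) (t^2 sigma^2/2 + o(1))).  The upper bound
   follows from Chernoff's inequality, the event that some summand exceeds
   N^alpha being negligible; the lower bound is the Gartner-Ellis argument done
   by hand: the part of E[exp(l T_n)] where T_n is not close to its typical
   value under the exponential tilting is bounded by G_n(l + m)^N and
   G_n(l - m)^N. *)
Require Import Defs.
From mathcomp Require Import all_boot all_order all_algebra.
From mathcomp Require Import finmap measurable_realfun.
From mathcomp Require Import all_classical all_reals all_analysis.
From mathcomp Require Import ring lra.
Import Order.TTheory GRing.Theory Num.Theory.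
Import numFieldNormedType.Exports.
Import HBNNSimple.
Local Open Scope classical_set_scope.
Local Open Scope ring_scope.

(** * Independence: from events to products of functions *)

(** Standard extension argument: the identity passes from indicators to simple functions by
    linearity, then to nonnegative measurable [g] by monotone convergence. It is what exchanges an
    indicator for a function in the product formula below. *)
Lemma integral_mul_comp {d} {T : measurableType d} {R : realType}
    (P : probability T R) (X : {RV P >-> R}) (Z : T -> R) (c : R) :
  measurable_fun setT Z -> (forall w, 0 <= Z w) -> 0 <= c ->
  (forall A : set R, measurable A ->
    (\int[P]_w (Z w * \1_A (X w))%:E = c%:E * \int[P]_w (\1_A (X w))%:E)%E) ->
  forall g : R -> R, measurable_fun setT g -> (forall x, 0 <= g x) ->
  (\int[P]_w (Z w * g (X w))%:E = c%:E * \int[P]_w (g (X w))%:E)%E.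
Proof.
move=> mZ Z0 c0 Hind g mg g0.
have mX : measurable_fun setT X by exact: measurable_funPT.
have mcomp (h : R -> R) : measurable_fun setT h ->
    measurable_fun setT (fun w => h (X w)).
  by move=> mh; apply: measurableT_comp.
have msfun (h : {nnsfun R >-> R}) : measurable_fun setT (h : R -> R).
  exact: measurable_funPT.
have Hs (h : {nnsfun R >-> R}) :
    (\int[P]_w (Z w * h (X w))%:E = c%:E * \int[P]_w (h (X w))%:E)%E.
  (* Past the end of the list of values, the coefficient is the default 0, so nonnegativity holds
     for every index. *)
  have h0 (i : nat) : 0 <= (enum_fset (fset_set (h @` setT)))`_i.
    have [ilt|ige] := ltnP i (size (enum_fset (fset_set (h @` setT)))); last first.
      by rewrite nth_default.
    have := mem_nth 0 ilt; rewrite in_fset_set//.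
    by rewrite inE => -[x _ <-]; exact: fun_ge0.
  have mpre r : measurable (h @^-1` [set r]).
    by rewrite -[_ @^-1` _]setTI; apply: msfun.
  under eq_integral do rewrite fimfunEord mulr_sumr -sumEFin.
  under [in RHS]eq_integral do rewrite fimfunEord -sumEFin.
  rewrite ge0_integral_sum//; last 2 first.
  - move=> i; apply/measurable_EFinP; apply: measurable_funM => //.
    by apply: measurable_funM => //; apply: mcomp; exact: measurable_indic.
  - by move=> i w _; rewrite lee_fin !mulr_ge0.
  rewrite ge0_integral_sum//; last 2 first.
  - move=> i; apply/measurable_EFinP; apply: measurable_funM => //.
    by apply: mcomp; exact: measurable_indic.
  - by move=> i w _; rewrite lee_fin mulr_ge0.
  rewrite ge0_sume_distrr; last first.
    by move=> i _; apply: integral_ge0 => w _; rewrite lee_fin mulr_ge0.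
  apply: eq_bigr => i _.
  under eq_integral do rewrite mulrCA EFinM.
  rewrite ge0_integralZl_EFin//; last 2 first.
  - by move=> w _; rewrite lee_fin mulr_ge0.
  - apply/measurable_EFinP; apply: measurable_funM => //.
    by apply: mcomp; exact: measurable_indic.
  under [in RHS]eq_integral do rewrite EFinM.
  rewrite [in RHS]ge0_integralZl_EFin//; last first.
    by apply/measurable_EFinP; apply: mcomp; exact: measurable_indic.
  by rewrite Hind// muleCA.
have mgE : measurable_fun setT (EFin \o g) by exact/measurable_EFinP.
have gE0 (x : R) : setT x -> (0 <= (EFin \o g) x)%E by rewrite lee_fin.
have [u [ndu ulim]] := approximation measurableT mgE gE0.
have lhs : (\int[P]_w (Z w * u n (X w))%:E @[n --> \oo] -->
    \int[P]_w (Z w * g (X w))%:E)%E.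
  have -> : (\int[P]_w (Z w * g (X w))%:E = \int[P]_w
     (limn (fun n => (Z w * u n (X w))%:E)))%E.
    apply: eq_integral => w _; apply/esym/cvg_lim => //.
    rewrite EFinM; under eq_fun do rewrite EFinM.
    by apply: cvgeZl => //; exact: ulim.
  apply: cvg_monotone_convergence => //.
  - move=> n; apply/measurable_EFinP; apply: measurable_funM => //.
    exact: mcomp.
  - by move=> n w _; rewrite lee_fin mulr_ge0.
  - move=> w _ m n mn; rewrite lee_fin ler_wpM2l//.
    by have /lefP := ndu _ _ mn; exact.
have rhs : (\int[P]_w (u n (X w))%:E @[n --> \oo] -->
    \int[P]_w (g (X w))%:E)%E.
  have -> : (\int[P]_w (g (X w))%:E = \int[P]_w
     (limn (fun n => (u n (X w))%:E)))%E.
    by apply: eq_integral => w _; apply/esym/cvg_lim => //; exact: ulim.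
  apply: cvg_monotone_convergence => //.
  - by move=> n; apply/measurable_EFinP; exact: mcomp.
  - by move=> n w _; rewrite lee_fin.
  - by move=> w _ m n mn; rewrite lee_fin; have /lefP := ndu _ _ mn; exact.
have rhs2 := cvgeZl (y := c%:E) isT rhs.
apply: (cvg_unique _ lhs) => //.
rewrite (_ : (fun n => _) = (fun n => c%:E * \int[P]_w (u n (X w))%:E)%E)//.
by apply/funext => n; exact: Hs.
Qed.

(** Independence is stated for events, that is, for products of indicators. Finiteness of the
    integrals keeps the product of the untouched factors a real constant, as [integral_mul_comp]
    requires. *)
Lemma integral_prod_independent {d} {T : measurableType d} {R : realType}
    (P : probability T R) (I : finType) (X : I -> {RV P >-> R})
    (f : I -> R -> R) :
  mutually_independent X ->
  (forall i, measurable_fun setT (f i)) -> (forall i x, 0 <= f i x) ->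
  (forall i, (\int[P]_w (f i (X i w))%:E < +oo)%E) ->
  (\int[P]_w (\prod_i f i (X i w))%:E = \prod_i \int[P]_w (f i (X i w))%:E)%E.
Proof.
move=> indX mf f0 foo.
pose h (s : seq I) (A : I -> set R) i x :=
  if i \in s then f i x else \1_(A i) x : R.
have mh s A i : (forall i, measurable (A i)) -> measurable_fun setT (h s A i).
  move=> mA; rewrite /h; case: (i \in s) => //; exact: measurable_indic.
have h0 s A i x : 0 <= h s A i x by rewrite /h; case: (i \in s).
have mX i : measurable_fun setT (X i) by exact: measurable_funPT.
have hoo s A i : (forall i, measurable (A i)) ->
    (\int[P]_w (h s A i (X i w))%:E \is a fin_num)%E.
  move=> mA; rewrite ge0_fin_numE; last first.
    by apply: integral_ge0 => w _; rewrite lee_fin.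
  rewrite /h; case: (i \in s) => //.
  have -> : (\int[P]_w (\1_(A i) (X i w))%:E = P (X i @^-1` A i))%E.
    rewrite -[in RHS](setIT (X i @^-1` A i)) -integral_indic//.
    by rewrite -[_ @^-1` _]setTI; exact: mX.
  by rewrite (le_lt_trans (probability_le1 _ _))// ?ltry//
    -[_ @^-1` _]setTI; exact: mX.
(* Indicators are replaced by the [f i] one index at a time; [s] lists the
   indices already treated. *)
suff H (s : seq I) (A : I -> set R) : uniq s -> (forall i, measurable (A i)) ->
    (\int[P]_w (\prod_i h s A i (X i w))%:E =
     \prod_i \int[P]_w (h s A i (X i w))%:E)%E.
  have := H (enum I) (fun=> setT) (enum_uniq _) (fun=> measurableT).
  rewrite /h; under eq_integral do under eq_bigr do rewrite mem_enum.
  by move=> ->; apply: eq_bigr => i _; rewrite mem_enum.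
elim: s A => [|a s IH] A /=.
  move=> _ mA.
  have mXA i : measurable (X i @^-1` A i) by rewrite -[_ @^-1` _]setTI; exact: mX.
  have := indX (finset.setTfor I) A mA.
  have -> : \bigcap_(i in [set` finset.setTfor I]) X i @^-1` A i = \bigcap_i (X i @^-1` A i).
    by apply/seteqP; split => w + i _ => /(_ i); apply => //=; rewrite inE.
  move=> indA; transitivity (P (\bigcap_i (X i @^-1` A i))).
    rewrite -[in RHS](setIT (\bigcap_i _)) -integral_indic//; last first.
      exact: fin_bigcap_measurable.
    apply: eq_integral => w _; congr EFin.
    rewrite indicE; have [win|] := boolP (w \in _).
      rewrite /h /= big1// => i _; rewrite indicE mem_set//.
      by move: win; rewrite inE => /(_ i); exact.
    rewrite notin_setE => /existsNP[i /not_implyP[_ nAi]].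
    by rewrite (bigD1 i)//= /h/= indicE memNset// mul0r.
  rewrite indA; apply: eq_big => i; first by rewrite inE.
  by move=> _; rewrite /h /= -[in LHS](setIT (X i @^-1` A i)) -integral_indic.
move=> /andP[aNs us] mA.
(* Since [a] is not yet treated, the induction hypothesis holds with any [B] as its set. With [Z]
   and [c] built from the other indices, this is the hypothesis on indicators in
   [integral_mul_comp]. *)
pose A' (B : set R) i := if i == a then B else A i.
have mA' B : measurable B -> forall i, measurable (A' B i).
  by move=> mB i; rewrite /A'; case: ifP.
pose Z w := \prod_(i | i != a) h s A i (X i w).
pose c := (\prod_(i | i != a) \int[P]_w (h s A i (X i w))%:E)%E.
have cfin : c \is a fin_num by apply: prode_fin_num => i _; exact: hoo.
have c0 : (0 <= c)%E.
  by apply: prode_ge0 => i _; apply: integral_ge0 => w _; rewrite lee_fin.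
have hA' B i : i != a -> h s (A' B) i = h s A i.
  by move=> ia; rewrite /h /A' (negbTE ia).
have haf : h (a :: s) A a = f a by rewrite /h mem_head.
have hs i : i != a -> h (a :: s) A i = h s A i.
  by move=> ia; rewrite /h inE (negbTE ia).
transitivity (\int[P]_w (Z w * f a (X a w))%:E)%E.
  apply: eq_integral => w _; congr EFin; rewrite (bigD1 a)//= mulrC haf.
  by congr (_ * _); apply: eq_bigr => i ia; rewrite hs.
transitivity (c * \int[P]_w (f a (X a w))%:E)%E; last first.
  rewrite [RHS](bigD1 a)//= muleC haf; congr (_ * _)%E.
  by apply: eq_bigr => i ia; rewrite hs.
rewrite -[c]fineK//; apply: integral_mul_comp => //.
- rewrite /Z; under eq_fun do rewrite -big_filter.
  by apply: measurable_prod => i _; apply: measurableT_comp => //; exact: mh.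
- by move=> w; apply: prodr_ge0.
- by rewrite fine_ge0.
move=> B mB; rewrite fineK//; have := IH (A' B) us (mA' B mB).
rewrite [in X in _ = X -> _](bigD1 a)//=.
under eq_integral do rewrite (bigD1 a)//=.
have -> : h s (A' B) a = \1_B by rewrite /h (negbTE aNs) /A' eqxx.
rewrite muleC => H; under eq_integral do rewrite mulrC.
etransitivity; last first.
  etransitivity; first exact: H; congr (_ * _)%E.
  by apply: eq_bigr => i ia; rewrite hA'.
apply: eq_integral => w _; congr EFin; congr (_ * _).
by apply: eq_bigr => i ia; rewrite hA'.
Qed.

(** * Truncated exponentials and their moment generating function *)

Lemma bounded_Rintegrable {d} {T : measurableType d} {R : realType}
    (P : probability T R) (f : T -> R) (C : R) :
  measurable_fun setT f -> (forall w, 0 <= f w <= C) ->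
  P.-integrable setT (EFin \o f).
Proof.
move=> mf fC; apply: measurable_bounded_integrable => //.
  exact: le_lt_trans (probability_le1 P measurableT) (ltry 1).
exists `|C|; split; first exact: num_real.
move=> x Cx w _ /=; have /andP[f0 fc] := fC w.
by rewrite ger0_norm// (le_trans fc)// (le_trans (ler_norm _))// ltW.
Qed.

Lemma Rintegrable_scale {d} {T : measurableType d} {R : realType}
    (P : probability T R) (k : R) (f : T -> R) :
  P.-integrable setT (EFin \o f) ->
  P.-integrable setT (EFin \o (fun w => k * f w)).
Proof. by move=> fi; have := integrableZl measurableT k fi. Qed.

Lemma Rintegrable_add {d} {T : measurableType d} {R : realType}
    (P : probability T R) (f g : T -> R) :
  P.-integrable setT (EFin \o f) -> P.-integrable setT (EFin \o g) ->
  P.-integrable setT (EFin \o (fun w => f w + g w)).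
Proof. by move=> fi gi; have := integrableD measurableT fi gi. Qed.

(** The cut is one-sided: for [l >= 0] the function is bounded by exp(l M), hence integrable
    whatever the tails of the variable. The indicator form gives measurability; estimates use the
    case form [truncated_expE]. *)
Definition truncated_exp {R : realType} (M l x : R) : R :=
  expR (l * x) * \1_(`]-oo, M[%classic) x.

Definition truncated_mgf {d} {T : measurableType d} {R : realType}
    (P : probability T R) (Y : T -> R) (M l : R) : R :=
  \int[P]_w truncated_exp M l (Y w).

Lemma truncated_expE {R : realType} (M l x : R) :
  truncated_exp M l x = if x < M then expR (l * x) else 0.
Proof.
rewrite /truncated_exp indicE; case: ltP => xM.
  by rewrite mem_set ?mulr1//= in_itv.
by rewrite memNset ?mulr0//= in_itv /= ltNge xM.
Qed.

Lemma truncated_exp_ge0 {R : realType} (M l x : R) : 0 <= truncated_exp M l x.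
Proof. by rewrite truncated_expE; case: ifP => // _; exact: expR_ge0. Qed.

Lemma truncated_exp_le {R : realType} (M l x : R) :
  0 <= l -> truncated_exp M l x <= expR (l * M).
Proof.
move=> l0; rewrite truncated_expE; case: ltP => [xM|_]; last exact: expR_ge0.
by rewrite ler_expR ler_wpM2l// ltW.
Qed.

Lemma measurable_truncated_exp {R : realType} (M l : R) :
  measurable_fun setT (truncated_exp M l).
Proof.
apply: measurable_funM; last exact: measurable_indic.
by apply: measurableT_comp => //; apply: measurable_funM.
Qed.

Lemma truncated_exp_integrable {d} {T : measurableType d} {R : realType}
    (P : probability T R) (X : {RV P >-> R}) (M l : R) : 0 <= l ->
  P.-integrable setT (EFin \o (fun w => truncated_exp M l (X w))).
Proof.
move=> l0; apply: (@bounded_Rintegrable _ _ _ _ _ (expR (l * M))) => [|w].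
  apply: measurableT_comp; first exact: measurable_truncated_exp.
  exact: measurable_funPT.
by rewrite truncated_exp_ge0 truncated_exp_le.
Qed.

Lemma truncated_mgf_ge0 {d} {T : measurableType d} {R : realType}
  (P : probability T R) (Y : T -> R) (M l : R) : 0 <= truncated_mgf P Y M l.
Proof. by apply: Rintegral_ge0 => w _; exact: truncated_exp_ge0. Qed.

Lemma same_distribution_integral {d} {T : measurableType d} {R : realType}
    (P : probability T R) (X Y : {RV P >-> R}) (f : R -> R) :
  same_distribution X Y -> measurable_fun setT f -> (forall x, 0 <= f x) ->
  (\int[P]_w (f (X w))%:E = \int[P]_w (f (Y w))%:E)%E.
Proof.
move=> XY mf f0; have mfE : measurable_fun setT (EFin \o f).
  exact/measurable_EFinP.
have fE0 y : (0 <= (EFin \o f) y)%E by rewrite lee_fin.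
have := ge0_integral_distribution X mfE fE0.
rewrite /comp /= => <-; have := ge0_integral_distribution Y mfE fE0.
rewrite /comp /= => <-.
by apply: eq_measure_integral => A mA _; exact: XY.
Qed.

Lemma truncated_exp_prod_integrable {d} {T : measurableType d} {R : realType}
    (P : probability T R) (I : finType) (X : I -> {RV P >-> R}) (M l : R) :
  0 <= l ->
  P.-integrable setT (EFin \o (fun w => \prod_i truncated_exp M l (X i w))).
Proof.
move=> l0.
apply: (@bounded_Rintegrable _ _ _ _ _ (\prod_(i : I) expR (l * M))) => [|w].
  apply: measurable_prod => i _.
  apply: measurableT_comp; first exact: measurable_truncated_exp.
  exact: measurable_funPT.
rewrite prodr_ge0 ?ler_prod// => i _; rewrite truncated_exp_ge0//=.
exact: truncated_exp_le.
Qed.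

(** The truncation acts on each summand rather than on the sum, so the integrand is a product of
    functions of independent variables. *)
Lemma truncated_mgf_sum {d} {T : measurableType d} {R : realType}
    (P : probability T R) (I : finType) (X : I -> {RV P >-> R})
    (Y : {RV P >-> R}) (M l : R) : iid_copies X Y -> 0 <= l ->
  \int[P]_w (\prod_i truncated_exp M l (X i w)) =
  truncated_mgf P Y M l ^+ #|I|.
Proof.
move=> [indX XY] l0; rewrite /Rintegral.
have Xfin (Z : {RV P >-> R}) :
    (\int[P]_w (truncated_exp M l (Z w))%:E)%E \is a fin_num.
  exact: (integrable_fin_num measurableT (truncated_exp_integrable P Z M l l0)).
have -> : (\int[P]_w (\prod_i truncated_exp M l (X i w))%:E =
    \prod_i \int[P]_w (truncated_exp M l (X i w))%:E)%E.
  apply: (integral_prod_independent _ _ X (fun=> truncated_exp M l)) => //.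
  - by move=> i; exact: measurable_truncated_exp.
  - by move=> i x; exact: truncated_exp_ge0.
  - by move=> i; rewrite -ge0_fin_numE ?integral_ge0// => w _;
      rewrite lee_fin truncated_exp_ge0.
rewrite (eq_bigr (fun=> (truncated_mgf P Y M l)%:E)) => [|i _]; last first.
  rewrite (same_distribution_integral _ _ Y)//; first by rewrite fineK.
  - exact: measurable_truncated_exp.
  - by move=> x; exact: truncated_exp_ge0.
by rewrite prodEFin /= prodr_const.
Qed.

(** * Non-asymptotic bounds for the tail of the sum *)

Lemma Rintegral_indic {d} {T : measurableType d} {R : realType}
    (P : probability T R) (A : set T) : measurable A ->
  \int[P]_w \1_A w = fine (P A).
Proof. by move=> mA; rewrite /Rintegral integral_indic// setIT. Qed.

Lemma indic_integrable {d} {T : measurableType d} {R : realType}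
    (P : probability T R) (A : set T) : measurable A ->
  P.-integrable setT (EFin \o (\1_A : T -> R)).
Proof.
move=> mA; apply: (@bounded_Rintegrable _ _ _ _ _ 1) => [|w].
  exact: measurable_indic.
by rewrite indicE; case: (w \in A); rewrite /= ?lexx ?ler01.
Qed.

Lemma measurable_RV_ge {d} {T : measurableType d} {R : realType}
    (f : T -> R) (t : R) : measurable_fun setT f ->
  measurable [set w | t <= f w].
Proof.
move=> mf; rewrite [X in measurable X](_ : _ = f @^-1` `[t, +oo[%classic).
  by rewrite -[_ @^-1` _]setTI; exact: mf.
by apply/seteqP; split => w /=; rewrite in_itv /= andbT.
Qed.

Lemma prod_truncated_exp {R : realType} (I : finType) (x : I -> R) (M l : R) :
  \prod_i truncated_exp M l (x i) =
  if [forall i, x i < M] then expR (l * \sum_i x i) else 0.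
Proof.
case: ifP => [/forallP xM|/negbT/forallPn[i xM]].
  rewrite mulr_sumr expR_sum; apply: eq_bigr => i _.
  by rewrite truncated_expE xM.
by rewrite (bigD1 i)//= truncated_expE (negbTE xM) mul0r.
Qed.

(** Union bound for the event that some summand reaches [M], and Chernoff's inequality on the
    complement. Both terms are written as integrals, so that a pointwise inequality suffices. *)
Lemma sum_tail_le {d} {T : measurableType d} {R : realType}
    (P : probability T R) (I : finType) (X : I -> {RV P >-> R})
    (Y : {RV P >-> R}) (M l t : R) : iid_copies X Y -> 0 <= l ->
  fine (P [set w | t <= \sum_i X i w]) <=
  #|I|%:R * fine (P [set w | M <= Y w]) +
  expR (- (l * t)) * truncated_mgf P Y M l ^+ #|I|.
Proof.
move=> iidX l0; rewrite -(truncated_mgf_sum _ _ X)//.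
have mX (Z : {RV P >-> R}) : measurable_fun setT Z by exact: measurable_funPT.
have mA : measurable [set w | t <= \sum_i X i w].
  by apply: measurable_RV_ge; apply: measurable_sum => i; exact: mX.
have mB i : measurable [set w | M <= X i w] by exact: measurable_RV_ge.
have XY i : P [set w | M <= X i w] = P [set w | M <= Y w].
  have := iidX.2 i `[M, +oo[%classic (measurable_itv _).
  rewrite /distribution /pushforward.
  have E (Z : T -> R) : [set w | M <= Z w] = Z @^-1` `[M, +oo[%classic.
    by apply/seteqP; split => w /=; rewrite in_itv /= andbT.
  by rewrite !E.
have -> : #|I|%:R * fine (P [set w | M <= Y w]) =
    \int[P]_w (\sum_i \1_([set w | M <= X i w]) w).
  rewrite /Rintegral; under eq_integral do rewrite -sumEFin.
  rewrite ge0_integral_sum//; last first.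
    by move=> i; apply/measurable_EFinP; exact: measurable_indic.
  rewrite (eq_bigr (fun=> (fine (P [set w | M <= Y w]))%:E)); last first.
    by move=> i _; rewrite -(XY i) fineK ?fin_num_measure// integral_indic// setIT.
  by rewrite sumEFin /= sumr_const mulr_natl.
have iprod := truncated_exp_prod_integrable P I X M l l0.
have isum : P.-integrable setT
    (EFin \o (fun w => \sum_i \1_([set w | M <= X i w]) w : R)).
  apply: (@bounded_Rintegrable _ _ _ _ _ (\sum_(i : I) 1)) => [|w].
    by apply: measurable_sum => i; exact: measurable_indic.
  by rewrite sumr_ge0//= ler_sum.
rewrite -RintegralZl// -Rintegral_indic// -RintegralD//; last first.
  exact: Rintegrable_scale.
apply: le_Rintegral => //.
- exact: indic_integrable.
- by apply: Rintegrable_add => //; exact: Rintegrable_scale.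
move=> w _; rewrite prod_truncated_exp.
have sum0 : 0 <= \sum_i \1_([set w | M <= X i w]) w :> R by exact: sumr_ge0.
(* If all summands are below [M], then 1 <= exp(l (S - t)) on the event; otherwise one of the
   indicators in the sum equals 1. *)
case: ifPn => [_|/forallPn[i]].
  rewrite indicE; have [|_] := boolP (w \in _); last first.
    by rewrite addr_ge0// -expRD expR_ge0.
  rewrite inE /= => tS; rewrite -[leLHS]add0r lerD// -expRD.
  by rewrite -[leLHS]expR0 ler_expR addrC subr_ge0 ler_wpM2l.
rewrite -leNgt => MX; rewrite mulr0 addr0 (bigD1 i)//=.
rewrite [X in _ <= X + _]indicE mem_set//=.
by rewrite -[leLHS]addr0 lerD ?sumr_ge0// indicE; case: (w \in _); rewrite ?ler01.
Qed.

(* Where the sum is not in [a, b[, exp(l S) is at most exp((l + m) S - m b) or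
   exp((l - m) S + m a); this avoids any change of measure. *)
Lemma sum_tail_ge {d} {T : measurableType d} {R : realType}
    (P : probability T R) (I : finType) (X : I -> {RV P >-> R})
    (Y : {RV P >-> R}) (M l m a b : R) : iid_copies X Y ->
    0 <= m -> m <= l ->
  expR (- (l * b)) * (truncated_mgf P Y M l ^+ #|I| -
    expR (- (m * b)) * truncated_mgf P Y M (l + m) ^+ #|I| -
    expR (m * a) * truncated_mgf P Y M (l - m) ^+ #|I|) <=
  fine (P [set w | a <= \sum_i X i w]).
Proof.
move=> iidX m0 ml; have l0 := le_trans m0 ml.
have lm0 : 0 <= l + m by rewrite addr_ge0.
have lm0' : 0 <= l - m by rewrite subr_ge0.
have mA : measurable [set w | a <= \sum_i X i w].
  by apply: measurable_RV_ge; apply: measurable_sum => i; exact: measurable_funPT.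
rewrite expRN mulrC ler_pdivrMr ?expR_gt0// !lerBlDr.
rewrite -!(truncated_mgf_sum _ _ X)// -Rintegral_indic//.
have iprod l' : 0 <= l' -> _ := truncated_exp_prod_integrable P I X M l'.
have iA := indic_integrable P _ mA.
rewrite [X in _ <= X + _ + _]mulrC -!RintegralZl//; try exact: iprod.
rewrite -!RintegralD//; try by do ?[apply: Rintegrable_add|
  apply: Rintegrable_scale|exact: iA|exact: iprod].
apply: le_Rintegral => //; try by do ?[apply: Rintegrable_add|
  apply: Rintegrable_scale|exact: iA|exact: iprod].
move=> w _; rewrite !prod_truncated_exp; case: ifPn => _; last first.
  by rewrite !mulr0 !addr0 mulr_ge0 ?expR_ge0.
rewrite -!expRD indicE; set S := \sum_i X i w.
(* For S >= b the term in [l + m] dominates; for a <= S <= b the indicator term pays exp(l b); for S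
   < a the term in [l - m] dominates. *)
have [|] := boolP (w \in _).
  rewrite inE /= => aS; rewrite mulr1.
  have [bS|/ltW Sb] := leP b S.
    have H1 : expR (l * S) <= expR (- (m * b) + (l + m) * S).
      by rewrite ler_expR mulrDl addrCA lerDl addrC subr_ge0 ler_wpM2l.
    have := expR_ge0 (l * b); have := expR_ge0 (m * a + (l - m) * S).
    by lra.
  have H1 : expR (l * S) <= expR (l * b) by rewrite ler_expR ler_wpM2l.
  have := expR_ge0 (- (m * b) + (l + m) * S).
  have := expR_ge0 (m * a + (l - m) * S).
  by lra.
rewrite notin_setE /= => /negP; rewrite -ltNge => /ltW Sa; rewrite mulr0.
have H1 : expR (l * S) <= expR (m * a + (l - m) * S).
  by rewrite ler_expR mulrBl addrCA lerDl subr_ge0 ler_wpM2l.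
have := expR_ge0 (- (m * b) + (l + m) * S).
by lra.
Qed.

(** * Second order expansion of the truncated moment generating function *)

(** The terms of degree k >= 3 are at most |x|^3 / k! in absolute value, and the sum of the 1 / k!
    is at most e. *)
Lemma expR_taylor2 {R : realType} (x : R) : `|x| <= 1 ->
  `|expR x - (1 + x + x ^+ 2 / 2)| <= expR 1 * `|x| ^+ 3.
Proof.
move=> x1; pose p := 1 + x + x ^+ 2 / 2.
have cx : series (exp_coeff x) n @[n --> \oo] --> expR x.
  exact: is_cvg_series_exp_coeff.
have nd1 : nondecreasing_seq (series (exp_coeff (1 : R))).
  apply/nondecreasing_seqP => n.
  by rewrite seriesSr lerDl exp_coeff_ge0.
have le1 n : series (exp_coeff (1 : R)) n <= expR 1.
  exact: nondecreasing_cvgn_le nd1 (is_cvg_series_exp_coeff _) n.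
have cn : `|series (exp_coeff x) n - p| @[n --> \oo] --> `|expR x - p|.
  by apply: cvg_norm; apply: cvgB => //; exact: cvg_cst.
rewrite -/p -(cvg_lim _ cn)//; apply: limr_le; first by apply/cvg_ex; eexists; exact: cn.
near=> n.
have n3 : (3 <= n)%N by near: n; exact: nbhs_infty_ge.
have -> : series (exp_coeff x) n - p = \sum_(3 <= k < n) exp_coeff x k.
  rewrite /series /= (big_cat_nat (n := 3))//= /p.
  rewrite big_nat_recl// big_nat_recl// big_nat1 /exp_coeff /= expr0 expr1.
  rewrite !factS fact0 !muln1 /= !divr1.
  by ring.
apply: (le_trans (ler_norm_sum _ _ _)).
apply: (@le_trans _ _ (`|x| ^+ 3 * \sum_(3 <= k < n) exp_coeff 1 k)).
  rewrite mulr_sumr big_nat_cond [leRHS]big_nat_cond.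
  apply: ler_sum => k /andP[/andP[k3 _] _].
  rewrite /exp_coeff /= expr1n mul1r normrM normfV normrX normr_nat.
  rewrite ler_wpM2r// ?invr_ge0// -(subnKC k3) exprD.
  by rewrite ler_piMr ?exprn_ge0// exprn_ile1.
rewrite mulrC ler_wpM2r ?exprn_ge0//; apply: le_trans (le1 n).
rewrite /series /= [leRHS](big_cat_nat (n := 3))//= lerDr.
by apply: sumr_ge0 => k _; exact: exp_coeff_ge0.
Unshelve. all: by end_near. Qed.

(** Near 0 the cubic error is at most a multiple of |x|^(2 + g) because g <= 1. Away from 0 each
    term is bounded by a multiple of x^2, hence of |x|^(2 + g) because g >= 0. *)
Lemma truncated_exp_taylor2 {R : realType} (B g : R) : 0 < B -> 0 <= g <= 1 ->
  exists2 C : R, 0 <= C & forall x,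
    `|truncated_exp B 1 x - (1 + x + x ^+ 2 / 2)| <= C * `|x| `^ (2 + g).
Proof.
(* Below [D] the cut is invisible and the Taylor bound applies. The two summands of [C] serve the
   ranges |x| < D and |x| >= D. *)
move=> B0 /andP[g0 g1]; pose D := Num.min B 1.
have D0 : 0 < D by rewrite lt_min B0 ltr01.
have D1 : D <= 1 by rewrite ge_min lexx orbT.
have DB : D <= B by rewrite ge_min lexx.
pose C := expR 1 + (expR B + 3) / D `^ (2 + g).
have C2 : 0 <= (expR B + 3) / D `^ (2 + g).
  by rewrite divr_ge0 ?powR_ge0// addr_ge0 ?expR_ge0.
exists C => [|x]; first by rewrite addr_ge0 ?expR_ge0.
have [xD|Dx] := ltP `|x| D.
  have xB : x < B by rewrite (le_lt_trans (ler_norm _))// (lt_le_trans xD).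
  have x1 : `|x| <= 1 by rewrite ltW// (lt_le_trans xD).
  rewrite truncated_expE mul1r xB (le_trans (expR_taylor2 _ x1))//.
  have [->|x0] := eqVneq x 0.
    by rewrite normr0 expr0n mulr0 mulr_ge0 ?powR_ge0// addr_ge0 ?expR_ge0.
  rewrite (@le_trans _ _ (expR 1 * `|x| `^ (2 + g)))//.
    rewrite ler_wpM2l ?expR_ge0// -powR_mulrn//.
    by apply: ger_powR; [rewrite normr_gt0 x0|lra].
  by rewrite ler_wpM2r ?powR_ge0// lerDl.
(* Now t >= 1, so exp(B) <= exp(B) t^2 and 1 + |x| + x^2 / 2 <= 3 t^2, while t^2 <= t^(2 + g). *)
pose t := `|x| / D.
have t1 : 1 <= t by rewrite ler_pdivlMr// mul1r.
have xt : `|x| <= t by rewrite ler_pdivlMr// ler_piMr.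
have tg : t ^+ 2 <= t `^ (2 + g).
  by rewrite -powR_mulrn ?(le_trans ler01)//; apply: ler_powR => //; lra.
have -> : C * `|x| `^ (2 + g) = expR 1 * `|x| `^ (2 + g) + (expR B + 3) * t `^ (2 + g).
  have DV : D^-1 `^ (2 + g) = (D `^ (2 + g))^-1.
    by rewrite -[D^-1]powR_inv1 ?ltW// -powRrM mulN1r powRN.
  rewrite /C mulrDl; congr (_ + _); rewrite /t powRM// ?invr_ge0 ?(ltW D0)// DV.
  by rewrite mulrA mulrAC.
have t2 : 1 <= t ^+ 2 by rewrite exprn_ege1.
have tt : t <= t ^+ 2 by rewrite ler_eXnr.
rewrite (@le_trans _ _ ((expR B + 3) * t ^+ 2))//; last first.
  rewrite -[leLHS]add0r lerD// ?mulr_ge0 ?expR_ge0 ?powR_ge0//.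
  by rewrite ler_wpM2l// addr_ge0 ?expR_ge0.
apply: (le_trans (ler_normB _ _)).
rewrite ger0_norm ?truncated_exp_ge0//.
have := @truncated_exp_le _ B 1 x ler01; rewrite mul1r => H1.
have H2 : `|1 + x + x ^+ 2 / 2| <= 1 + `|x| + `|x| ^+ 2 / 2.
  apply: (le_trans (ler_normD _ _)); rewrite lerD//.
    by rewrite (le_trans (ler_normD _ _))// normr1.
  by rewrite normrM normrX normfV normr_nat.
have H3 : `|x| ^+ 2 <= t ^+ 2 by rewrite lerXn2r// nnegrE (le_trans ler01).
have H4 : expR B <= expR B * t ^+ 2 by rewrite ler_peMr// expR_ge0.
by lra.
Qed.

(** Cutting [Y] at [B / l] is cutting l Y at [B], so the pointwise bound at l Y can be integrated;
    centering kills the linear term. [C] is chosen before the probability space, hence is uniform in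
    n. *)
Lemma truncated_mgf_taylor2 {R : realType} (B g : R) : 0 < B -> 0 <= g <= 1 ->
  exists2 C : R, 0 <= C &
  forall d (T : measurableType d) (P : probability T R) (Y : {RV P >-> R}) (l : R),
  0 < l ->
  P.-integrable setT (EFin \o Y) -> \int[P]_w Y w = 0 ->
  P.-integrable setT (EFin \o (fun w => Y w ^+ 2)) ->
  P.-integrable setT (EFin \o (fun w => `|Y w| `^ (2 + g))) ->
  `|truncated_mgf P Y (B / l) l - (1 + l ^+ 2 / 2 * \int[P]_w (Y w ^+ 2))| <=
  C * l `^ (2 + g) * \int[P]_w (`|Y w| `^ (2 + g)).
Proof.
move=> B0 g01; have [C C0 HC] := truncated_exp_taylor2 _ _ B0 g01.
exists C => // d T P Y l l0 iY EY0 iY2 iYg.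
have it := truncated_exp_integrable P Y (B / l) l (ltW l0).
have i1 : P.-integrable setT (EFin \o (cst 1 : T -> R)).
  by apply: (@bounded_Rintegrable _ _ _ _ _ 1) => // w; rewrite ler01 lexx.
have iq : P.-integrable setT
    (EFin \o (fun w => (1 + l * Y w + l ^+ 2 / 2 * Y w ^+ 2))).
  apply: Rintegrable_add; last exact: Rintegrable_scale.
  by apply: Rintegrable_add => //; exact: Rintegrable_scale.
have -> : 1 + l ^+ 2 / 2 * \int[P]_w Y w ^+ 2 =
    \int[P]_w (1 + l * Y w + l ^+ 2 / 2 * Y w ^+ 2).
  rewrite RintegralD//; last 2 first.
  - by apply: Rintegrable_add => //; exact: Rintegrable_scale.
  - exact: Rintegrable_scale.
  rewrite RintegralD//; last exact: Rintegrable_scale.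
  rewrite !RintegralZl// EY0 mulr0 addr0 Rintegral_cst//.
  by rewrite mul1r (congr1 fine (probability_setT P : _ = _)).
rewrite /truncated_mgf -RintegralB// -RintegralZl//.
have iB : P.-integrable setT (EFin \o (fun w => truncated_exp (B / l) l (Y w) -
    (1 + l * Y w + l ^+ 2 / 2 * Y w ^+ 2))).
  by have := integrableB measurableT it iq.
apply: (le_trans (le_normr_Rintegral measurableT iB)).
apply: le_Rintegral => //.
- exact: (integrable_norm iB).
- exact: Rintegrable_scale.
move=> w _; have := HC (l * Y w).
rewrite !truncated_expE mul1r ltr_pdivlMr// [Y w * l]mulrC.
rewrite exprMn normrM powRM// (gtr0_norm l0) mulrA.
by rewrite mulrAC.
Qed.

(** * Raising the truncation level *)

Lemma truncated_mgf_le {d} {T : measurableType d} {R : realType}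
    (P : probability T R) (Y : {RV P >-> R}) (M M' l : R) :
  0 <= l -> M <= M' -> truncated_mgf P Y M l <= truncated_mgf P Y M' l.
Proof.
move=> l0 MM'; apply: le_Rintegral => //.
- exact: truncated_exp_integrable.
- exact: truncated_exp_integrable.
move=> w _; rewrite !truncated_expE; case: ltP => [/lt_le_trans ->//|_].
by case: ifP => // _; exact: expR_ge0.
Qed.

(** What the level [M'] adds lives on Y >= M, where the integrand is at most exp(l M'). *)
Lemma truncated_mgf_step {d} {T : measurableType d} {R : realType}
    (P : probability T R) (Y : {RV P >-> R}) (M M' l : R) : 0 <= l ->
  truncated_mgf P Y M' l <=
  truncated_mgf P Y M l + expR (l * M') * fine (P [set w | M <= Y w]).
Proof.
move=> l0; have mA : measurable [set w | M <= Y w].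
  by apply: measurable_RV_ge; exact: measurable_funPT.
have iA := indic_integrable P _ mA.
have iM := truncated_exp_integrable P Y M l l0.
rewrite -Rintegral_indic// -RintegralZl// -RintegralD//; last first.
  exact: Rintegrable_scale.
apply: le_Rintegral => //.
- exact: truncated_exp_integrable.
- by apply: Rintegrable_add => //; exact: Rintegrable_scale.
move=> w _; rewrite !truncated_expE indicE.
have [_|MY] := ltP (Y w) M.
  case: ifP => _; first by rewrite lerDl mulr_ge0 ?expR_ge0.
  by rewrite addr_ge0 ?mulr_ge0 ?expR_ge0.
rewrite mem_set// mulr1 add0r; case: ltP => [YM|_]; last exact: expR_ge0.
by rewrite ler_expR ler_wpM2l// ltW.
Qed.

(** Iterated along a grid, each slab pays the exponential at its upper end and the tail probability
    at its lower end. *)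
Lemma truncated_mgf_chain {d} {T : measurableType d} {R : realType}
    (P : probability T R) (Y : {RV P >-> R}) (u : nat -> R) (K : nat) (l : R) :
  0 <= l -> truncated_mgf P Y (u K) l <= truncated_mgf P Y (u 0%N) l +
    \sum_(j < K) expR (l * u j.+1) * fine (P [set w | u j <= Y w]).
Proof.
move=> l0; elim: K => [|K IH]; first by rewrite big_ord0 addr0.
rewrite big_ord_recr /= addrA.
by rewrite (le_trans (truncated_mgf_step P Y (u K) (u K.+1) l l0))// lerD2r.
Qed.

(** * Comparison of powers, logarithms and exponentials at infinity *)

Lemma near_pinfty_ge_powR {R : realType} (a A : R) : 0 < a ->
  \forall x \near +oo, A <= x `^ a.
Proof.
move=> a0; pose A' := Num.max A 1.
have A'0 : 0 < A' by rewrite lt_max ltr01 orbT.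
near=> x; apply: (@le_trans _ _ A'); first by rewrite le_max lexx.
have -> : A' = (A' `^ a^-1) `^ a by rewrite -powRrM mulVf ?gt_eqF// powRr1 ?ltW.
have xA : A' `^ a^-1 <= x.
  by near: x; apply: nbhs_pinfty_ge; exact: num_real.
apply: ge0_ler_powR => //; rewrite ?nnegrE ?powR_ge0 ?(ltW a0)//.
Unshelve. all: by end_near. Qed.

Lemma near_pinfty_powR_le {R : realType} (a b C c : R) : a < b -> 0 < c ->
  \forall x \near +oo, C * x `^ a <= c * x `^ b.
Proof.
move=> ab c0; near=> x.
have x0 : 0 < x by near: x; apply: nbhs_pinfty_gt; exact: num_real.
have -> : b = a + (b - a) by ring.
rewrite powRD ?(gt_eqF x0) ?implybT// mulrCA mulrC ler_pM2l ?powR_gt0//.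
rewrite -ler_pdivrMl//.
by near: x; apply: near_pinfty_ge_powR; rewrite subr_gt0.
Unshelve. all: by end_near. Qed.

(** Writing ln x as (2 / b) ln(x^(b/2)) bounds it by a multiple of x^(b/2); the other half of the
    exponent absorbs the constants. *)
Lemma near_pinfty_ln_le {R : realType} (b k c : R) : 0 < b -> 0 < c ->
  \forall x \near +oo, k * ln x <= c * x `^ b.
Proof.
move=> b0 c0; near=> x.
have x1 : 1 <= x by near: x; apply: nbhs_pinfty_ge; exact: num_real.
have x0 : 0 < x by rewrite (lt_le_trans ltr01).
apply: (@le_trans _ _ (`|k| * (2 / b) * x `^ (b / 2))); last first.
  by near: x; apply: near_pinfty_powR_le => //; lra.
apply: (@le_trans _ _ (`|k| * ln x)).
  by rewrite ler_wpM2r ?ln_ge0// ler_norm.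
rewrite -mulrA ler_wpM2l//.
have -> : ln x = 2 / b * ln (x `^ (b / 2)).
  have b1 : b != 0 by rewrite gt_eqF.
  by rewrite ln_powR; field.
rewrite ler_pM2l ?divr_gt0// ltW// ln_sublinear// powR_gt0//.
Unshelve. all: by end_near. Qed.

(** After taking logarithms, each of C x^a, - k ln x and - ln e is eventually at most a quarter of c
    x^b. *)
Lemma near_pinfty_expR_powR {R : realType} (a b C c e k : R) :
  0 < b -> a < b -> 0 < c -> 0 < e ->
  \forall x \near +oo,
    expR (C * x `^ a) * expR (- (c * x `^ b)) <= e * x `^ k.
Proof.
move=> b0 ab c0 e0; have c4 : 0 < c / 4 by rewrite divr_gt0.
near=> x.
have x0 : 0 < x by near: x; apply: nbhs_pinfty_gt; exact: num_real.
have H1 : C * x `^ a <= c / 4 * x `^ b.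
  by near: x; apply: near_pinfty_powR_le.
have H2 : - k * ln x <= c / 4 * x `^ b.
  by near: x; apply: near_pinfty_ln_le.
have H3 : - ln e <= c / 4 * x `^ b.
  rewrite -ler_pdivrMl//; by near: x; apply: near_pinfty_ge_powR.
have -> : x `^ k = expR (k * ln x) by rewrite /powR gt_eqF.
rewrite -{1}[e]lnK ?posrE// -!expRD ler_expR.
by have := powR_ge0 x b; nra.
Unshelve. all: by end_near. Qed.

(** * Asymptotics of the truncated moment generating function and its powers *)

(** Adds up three errors of size [e]: the Taylor remainder at the low truncation level, the
    convergence of the variance, and the grid sum [S]. *)
Lemma ler_dist_sandwich {R : realType} (a0 a S m c e e' : R) :
  `|a0 - (1 + m)| <= e -> `|m - c| <= e -> a0 <= a -> a <= a0 + S -> S <= e ->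
  e * 3 = e' -> `|a - (1 + c)| <= e'.
Proof.
rewrite !ler_distl => /andP[H1 H2] /andP[H3 H4] H5 H6 H7 <-.
by apply/andP; split; lra.
Qed.

Lemma truncated_mgf_asymp {R : realType} (d : nat -> measure_display)
    (Omega : forall n : nat, measurableType (d n))
    (P : forall n : nat, probability (Omega n) R)
    (Y : forall n : nat, {RV (P n) >-> R}) (r : nat -> R)
    (eps q sigma alpha g : R) :
  r n @[n --> \oo] --> +oo ->
  0 < eps -> eps < 1 -> 0 < q -> 1 / 2 < alpha -> alpha * (1 + eps) < 1 -> 0 < g <= 1 ->
  (\forall n \near \oo, [/\ (P n).-integrable setT (EFin \o Y n),
     \int[P n]_w Y n w = 0,
     (P n).-integrable setT (EFin \o (fun w => Y n w ^+ 2)) &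
     (P n).-integrable setT (EFin \o (fun w => `|Y n w| `^ (2 + g)))]) ->
  \int[P n]_w (Y n w ^+ 2) @[n --> \oo] --> sigma ^+ 2 ->
  (\int[P n]_w (`|Y n w| `^ (2 + g))) / r n `^ (g * (1 - alpha)) @[n --> \oo]
    --> 0 ->
  (forall s, alpha * eps <= s <= alpha -> \forall n \near \oo,
     fine (P n [set w | r n `^ s <= Y n w]) <=
     expR (- (q / 2 * r n `^ (s * (1 - eps))))) ->
  forall t e, 0 < t -> 0 < e -> \forall n \near \oo,
    `|truncated_mgf (P n) (Y n) (r n `^ alpha) (t * r n `^ (alpha - 1)) -
      (1 + t ^+ 2 * sigma ^+ 2 / 2 * r n `^ (2 * alpha - 2))| <=
    e * r n `^ (2 * alpha - 2).
Proof.
move=> roo eps0 eps1 q0 alpha2 alphae g01 HY var mom tail t e t0 e0.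
have near_r (A : R -> Prop) : (\forall x \near +oo, A x) ->
    \forall n \near \oo, A (r n) by move=> HA; exact: roo HA.
have near_gt0 : \forall n \near \oo, 0 < r n.
  exact: (near_r (fun x => 0 < x) (nbhs_pinfty_gt (num_real 0))).
have near_ge1 : \forall n \near \oo, 1 <= r n.
  exact: (near_r (fun x => 1 <= x) (nbhs_pinfty_ge (num_real 1))).
have alpha1 : alpha < 1 by nra.
have alphaC : 1 - alpha <= alpha by lra.
have g01' : 0 <= g <= 1 by lra.
have [C C0 HC] := truncated_mgf_taylor2 _ _ t0 g01'.
(* [kappa] is the slack in the upper bound on [alpha]. [K] is so large that [K] equal steps leading
   from 1 - alpha to alpha are shorter than [kappa]. *)
pose kappa := 1 - alpha * (1 + eps).
have kappa0 : 0 < kappa by rewrite subr_gt0.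
have [K [K0 HK]] : exists K : nat, (0 < K)%N /\ 2 * alpha - 1 < K%:R * kappa.
  exists (Num.bound ((2 * alpha - 1) / kappa)).+1; split => //.
  rewrite -ltr_pdivrMr// (lt_trans (archi_boundP _))//.
    by rewrite divr_ge0 ?(ltW kappa0)//; lra.
  by rewrite ltr_nat.
have K0' : (0 : R) < K%:R by rewrite ltr0n.
pose h := (2 * alpha - 1) / K%:R.
have h0 : 0 < h by rewrite divr_gt0//; lra.
have hk : h < kappa by rewrite /h ltr_pdivrMr// [kappa * _]mulrC.
(* Consecutive cut levels r^(s j) are so close that
   alpha - 1 + s j.+1 < s j * (1 - eps). *)
pose s (j : nat) := 1 - alpha + j%:R * h.
have sK : s K = alpha by rewrite /s /h; field; rewrite gt_eqF.
have s_ge j : 1 - alpha <= s j by rewrite lerDl mulr_ge0 ?(ltW h0).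
have s_le j : (j <= K)%N -> s j <= alpha.
  by move=> jK; rewrite -sK lerD2l ler_wpM2r ?(ltW h0)// ler_nat.
have eK : 0 < e / (3 * K%:R) by rewrite divr_gt0// mulr_gt0.
have Hj (j : 'I_K) : \forall n \near \oo,
    expR (t * r n `^ (alpha - 1) * r n `^ s j.+1) *
    fine (P n [set w | r n `^ s j <= Y n w]) <=
    e / (3 * K%:R) * r n `^ (2 * alpha - 2).
  (* Positivity of [kappa] also says that the lowest level 1 - alpha exceeds alpha * eps, so the
     tail estimate covers the whole grid. *)
  have sI : alpha * eps <= s j <= alpha.
    rewrite (s_le j (ltnW (ltn_ord j))) andbT (le_trans _ (s_ge j))//.
    by move: kappa0; rewrite /kappa; clear; lra.
  have sj1 := s_ge j; have sj2 := s_le j (ltnW (ltn_ord j)).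
  have b0 : 0 < s j * (1 - eps).
    by rewrite mulr_gt0// ?subr_gt0// (lt_le_trans _ sj1)// subr_gt0.
  have ab : alpha - 1 + s j.+1 < s j * (1 - eps).
    have -> : s j.+1 = s j + h by rewrite /s -natr1; ring.
    have : s j * eps <= alpha * eps by rewrite ler_wpM2r// ltW.
    by move: hk; rewrite /kappa; clear; lra.
  have q20 : 0 < q / 2 by rewrite divr_gt0.
  have Hr := near_r _ (near_pinfty_expR_powR _ _ t _ _ (2 * alpha - 2) b0 ab q20 eK).
  have Ht := tail _ sI.
  near=> n.
  have rn0 : 0 < r n by near: n.
  apply: (@le_trans _ _ (expR (t * r n `^ (alpha - 1 + s j.+1)) *
      expR (- (q / 2 * r n `^ (s j * (1 - eps)))))); last first.
    by near: n.
  rewrite -mulrA -powRD ?(gt_eqF rn0) ?implybT// ler_wpM2l ?expR_ge0//.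
  by near: n.
have {}Hj : \forall n \near \oo, forall j : 'I_K,
    expR (t * r n `^ (alpha - 1) * r n `^ s j.+1) *
    fine (P n [set w | r n `^ s j <= Y n w]) <=
    e / (3 * K%:R) * r n `^ (2 * alpha - 2).
  exact: filter_forall Hj.
(* A strictly positive majorant, since [C] may vanish and [D] is a divisor below. *)
have [D D0] : exists2 D, 0 < D & C * t `^ (2 + g) <= D.
  exists (C * t `^ (2 + g) + 1); last by rewrite lerDl.
  by rewrite ltr_wpDl// mulr_ge0// powR_ge0.
move=> HD.
(* Tolerances for the normalised moment and for the variance; multiplied by [D] and by t^2 / 2
   respectively, each becomes e / 3. *)
have e3D : 0 < e / (3 * D) by rewrite divr_gt0// mulr_gt0.
have e3t : 0 < 2 * e / (3 * t ^+ 2) by rewrite divr_gt0// ?mulr_gt0// exprn_gt0.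
near=> n.
have Hjn := near Hj n.
have r1 : 1 <= r n by near: n.
have r0 : 0 < r n by rewrite (lt_le_trans ltr01).
have [iY EY0 iY2 iYg] : [/\ (P n).-integrable setT (EFin \o Y n),
     \int[P n]_w Y n w = 0,
     (P n).-integrable setT (EFin \o (fun w => Y n w ^+ 2)) &
     (P n).-integrable setT (EFin \o (fun w => `|Y n w| `^ (2 + g)))].
  by near: n.
set l := t * r n `^ (alpha - 1).
have l0 : 0 < l by rewrite mulr_gt0// powR_gt0.
have l2 : l ^+ 2 = t ^+ 2 * r n `^ (2 * alpha - 2).
  rewrite exprMn -[_ `^ _ ^+ 2]powR_mulrn ?powR_ge0// -powRrM.
  by congr (_ * _ `^ _); ring.
(* The denominator is exactly the rate in (iii), so the Taylor remainder is small compared with r^(2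
   alpha - 2). *)
have lg : l `^ (2 + g) =
    t `^ (2 + g) * (r n `^ (2 * alpha - 2) / r n `^ (g * (1 - alpha))).
  rewrite powRM ?(ltW t0) ?powR_ge0// -powRrM -powRB; last first.
    by rewrite (gt_eqF r0) implybT.
  by congr (_ * _ `^ _); ring.
(* Taking B = t in the expansion puts the cut at the first grid level. *)
have tl : t / l = r n `^ (1 - alpha).
  have -> : 1 - alpha = - (alpha - 1) by ring.
  by rewrite powRN /l invfM mulrA divff ?gt_eqF// mul1r.
have := HC _ _ (P n) (Y n) l l0 iY EY0 iY2 iYg.
rewrite tl l2 lg.
set m := \int[P n]_w _ ^+ 2; set mg := \int[P n]_w _ `^ _.
set V := r n `^ (2 * alpha - 2); set W := r n `^ (g * (1 - alpha)).
have V0 : 0 < V by rewrite powR_gt0.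
have Hm : `|sigma ^+ 2 - m| <= 2 * e / (3 * t ^+ 2).
  rewrite /m; near: n; apply: cvgr_dist_le => //.
have Hmg : `|mg / W| <= e / (3 * D).
  rewrite /mg /W; near: n.
  move/cvgr0Pnorm_le : mom => /(_ _ e3D); exact.
have mg0 : 0 <= mg by apply: Rintegral_ge0 => w _; exact: powR_ge0.
move: Hmg; rewrite ger0_norm ?divr_ge0 ?powR_ge0// => Hmg.
have E1 : C * (t `^ (2 + g) * (V / W)) * mg <= e / 3 * V.
  have -> : C * (t `^ (2 + g) * (V / W)) * mg = C * t `^ (2 + g) * (mg / W) * V.
    by rewrite !mulrA; ring.
  rewrite ler_wpM2r ?(ltW V0)//.
  apply: (@le_trans _ _ (D * (e / (3 * D)))).
    by apply: ler_pM => //; rewrite ?divr_ge0 ?powR_ge0// mulr_ge0 ?powR_ge0.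
  have -> // : D * (e / (3 * D)) = e / 3 by field; rewrite gt_eqF.
have E2 : t ^+ 2 * V / 2 * `|sigma ^+ 2 - m| <= e / 3 * V.
  have t20 : 0 < t ^+ 2 by rewrite exprn_gt0.
  apply: (@le_trans _ _ (t ^+ 2 * V / 2 * (2 * e / (3 * t ^+ 2)))).
    by rewrite ler_wpM2l// divr_ge0// mulr_ge0// ltW.
  by rewrite le_eqVlt; apply/orP; left; apply/eqP; field; rewrite gt_eqF.
have lo := @truncated_mgf_le _ _ _ (P n) (Y n) (r n `^ (1 - alpha)) (r n `^ alpha) l (ltW l0).
have {}lo := lo (ler_powR r1 alphaC).
have hi := truncated_mgf_chain (P n) (Y n) (fun j => r n `^ s j) K l (ltW l0).
have s0 : s 0%N = 1 - alpha by rewrite /s mul0r addr0.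
move: hi; rewrite sK s0 => hi.
have hS : \sum_(j < K) expR (l * r n `^ s j.+1) *
    fine (P n [set w | r n `^ s j <= Y n w]) <= e / 3 * V.
  have -> : e / 3 * V = \sum_(j < K) (e / (3 * K%:R) * V).
    by rewrite sumr_const card_ord -mulr_natr; field; rewrite gt_eqF.
  by apply: ler_sum => j _; exact: Hjn.
move=> H.
have E3 : `|t ^+ 2 * V / 2 * m - t ^+ 2 * sigma ^+ 2 / 2 * V| <= e / 3 * V.
  apply: le_trans E2; rewrite distrC.
  have -> : t ^+ 2 * sigma ^+ 2 / 2 * V - t ^+ 2 * V / 2 * m =
     t ^+ 2 * V / 2 * (sigma ^+ 2 - m) by ring.
  by rewrite normrM ger0_norm// divr_ge0// mulr_ge0// ?exprn_ge0// ltW.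
apply: (ler_dist_sandwich _ _ _ _ _ _ _ (le_trans H E1) E3 lo hi hS).
by field.
Unshelve. all: by end_near. Qed.

Lemma exprn_le_expR {R : realType} (n : nat) (G x : R) :
  0 <= G -> G <= 1 + x -> G ^+ n <= expR (n%:R * x).
Proof.
move=> G0 Gx; rewrite expRM_natl lerXn2r// ?nnegrE ?expR_ge0//.
exact: le_trans (expR_ge1Dx x).
Qed.

(** From (1 + x) (1 - x + x^2) = 1 + x^3 >= 1 one gets 1 / (1 + x) <= 1 - (x - x^2) <= exp(- (x -
    x^2)). *)
Lemma exprn_ge_expR {R : realType} (n : nat) (G x : R) :
  0 <= x -> 1 + x <= G -> expR (n%:R * (x - x ^+ 2)) <= G ^+ n.
Proof.
move=> x0 xG; have G0 : 0 <= G by apply: le_trans xG; rewrite addr_ge0.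
rewrite expRM_natl lerXn2r// ?nnegrE ?expR_ge0//; apply: le_trans xG.
have w0 : 0 < 1 - (x - x ^+ 2) by have := sqr_ge0 (x - 1); nra.
rewrite -[leLHS]invrK -expRN -[leRHS]invrK lef_pV2 ?posrE ?expR_gt0//; last first.
  by rewrite invr_gt0; lra.
apply: le_trans (expR_ge1Dx _).
rewrite -[_^-1]mul1r ler_pdivrMr; last by lra.
have : 0 <= x ^+ 3 by rewrite exprn_ge0.
by rewrite !exprS expr0; lra.
Qed.

(** A deviation from 1 of order W = N^(2 alpha - 2) gives, after N factors, an exponent of order N
    W; the quadratic correction is of order N W^2, negligible since alpha < 1. *)
Lemma truncated_mgf_exprn_asymp {R : realType} (d : nat -> measure_display)
    (Omega : forall n : nat, measurableType (d n))
    (P : forall n : nat, probability (Omega n) R)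
    (Y : forall n : nat, {RV (P n) >-> R}) (N : nat -> nat) (sigma alpha : R) :
  (N n)%:R @[n --> \oo] --> (+oo : set_system R) ->
  0 < sigma -> alpha < 1 ->
  (forall t e, 0 < t -> 0 < e -> \forall n \near \oo,
    `|truncated_mgf (P n) (Y n) ((N n)%:R `^ alpha) (t * (N n)%:R `^ (alpha - 1)) -
      (1 + t ^+ 2 * sigma ^+ 2 / 2 * (N n)%:R `^ (2 * alpha - 2))| <=
    e * (N n)%:R `^ (2 * alpha - 2)) ->
  forall t e, 0 < t -> 0 < e -> \forall n \near \oo,
    expR ((t ^+ 2 * sigma ^+ 2 / 2 - e) * (N n)%:R `^ (2 * alpha - 1)) <=
    truncated_mgf (P n) (Y n) ((N n)%:R `^ alpha)
      (t * (N n)%:R `^ (alpha - 1)) ^+ N n <=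
    expR ((t ^+ 2 * sigma ^+ 2 / 2 + e) * (N n)%:R `^ (2 * alpha - 1)).
Proof.
move=> roo sigma0 alpha1 H t e t0 e0; pose c := t ^+ 2 * sigma ^+ 2 / 2.
have c0 : 0 < c by rewrite divr_gt0// mulr_gt0// exprn_gt0.
have e20 : 0 < e / 2 by rewrite divr_gt0.
(* The cap [c] keeps c - e1 nonnegative for the lower bound; the other e / 2 is left for the
   quadratic correction. *)
pose e1 := Num.min (e / 2) c.
have e10 : 0 < e1 by rewrite lt_min c0 e20.
have e1e : e1 <= e / 2 by rewrite ge_min lexx.
have e1c : e1 <= c by rewrite ge_min lexx orbT.
have e2e : e / 2 <= e by lra.
have near_r (A : R -> Prop) : (\forall x \near +oo, A x) ->
    \forall n \near \oo, A (N n)%:R by move=> HA; exact: roo HA.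
have near_gt0 : \forall n \near \oo, 0 < (N n)%:R :> R.
  exact: (near_r (fun x => 0 < x) (nbhs_pinfty_gt (num_real 0))).
have a0 : 2 * alpha - 2 < 0 by lra.
have Hs := near_r _ (near_pinfty_powR_le _ _ (c ^+ 2) _ a0 e20).
have := H t e1 t0 e10; rewrite -/c => Hn.
near=> n.
have r0 : 0 < (N n)%:R :> R by near: n.
have W0 : 0 < ((N n)%:R : R) `^ (2 * alpha - 2) by rewrite powR_gt0.
have VW : ((N n)%:R : R) `^ (2 * alpha - 1) =
    (N n)%:R * (N n)%:R `^ (2 * alpha - 2).
  have -> : 2 * alpha - 1 = 1 + (2 * alpha - 2) by ring.
  by rewrite powRD ?(gt_eqF r0) ?implybT// powRr1// ltW.
have : c ^+ 2 * (N n)%:R `^ (2 * alpha - 2) <= e / 2 * (N n)%:R `^ 0.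
  by near: n.
rewrite powRr0 mulr1 -/c VW.
have : `|truncated_mgf (P n) (Y n) ((N n)%:R `^ alpha)
     (t * (N n)%:R `^ (alpha - 1)) - (1 + c * (N n)%:R `^ (2 * alpha - 2))| <=
    e1 * (N n)%:R `^ (2 * alpha - 2) by near: n.
set W := (N n)%:R `^ (2 * alpha - 2) in W0 *.
have := truncated_mgf_ge0 (P n) (Y n) ((N n)%:R `^ alpha) (t * (N n)%:R `^ (alpha - 1)).
move: (truncated_mgf _ _ _ _) => G G0.
rewrite ler_distl => /andP[G1 G2] cW.
have G3 : 1 + (c - e1) * W <= G by rewrite mulrBl addrA.
have G4 : G <= 1 + (c + e) * W.
  rewrite (le_trans G2)// -addrA -mulrDl lerD2l ler_wpM2r ?(ltW W0)//.
  by rewrite lerD2l (le_trans e1e).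
apply/andP; split; last by rewrite mulrCA exprn_le_expR.
have x0 : 0 <= (c - e1) * W by rewrite mulr_ge0 ?subr_ge0// ltW.
apply: le_trans (exprn_ge_expR (N n) _ _ x0 G3).
rewrite ler_expR mulrCA ler_wpM2l ?(ltW r0)//.
have c2 : (c - e1) ^+ 2 * W <= e / 2.
  apply: le_trans cW; rewrite ler_wpM2r ?(ltW W0)//.
  by rewrite lerXn2r ?nnegrE ?subr_ge0 ?(ltW c0)// gerBl ltW.
have -> : ((c - e1) * W) ^+ 2 = (c - e1) ^+ 2 * W * W by rewrite exprMn mulrA.
rewrite -mulrBl ler_wpM2r ?(ltW W0)//.
by move: c2 e1e; clear; lra.
Unshelve. all: by end_near. Qed.

(** * Exponential upper and lower bounds for the deviations of the sum *)

Lemma sum_tail_upper {R : realType} (d : nat -> measure_display)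
    (Omega : forall n : nat, measurableType (d n))
    (P : forall n : nat, probability (Omega n) R) (N : nat -> nat)
    (Y : forall n : nat, {RV (P n) >-> R})
    (X : forall n : nat, 'I_(N n) -> {RV (P n) >-> R})
    (eps q sigma alpha : R) :
  (N n)%:R @[n --> \oo] --> (+oo : set_system R) ->
  (\forall n \near \oo, iid_copies (X n) (Y n)) ->
  0 < sigma -> 0 < q -> 1 / 2 < alpha -> alpha * (1 + eps) < 1 ->
  (\forall n \near \oo, fine (P n [set w | (N n)%:R `^ alpha <= Y n w]) <=
     expR (- (q * (N n)%:R `^ (alpha * (1 - eps))))) ->
  (forall t e, 0 < t -> 0 < e -> \forall n \near \oo,
    truncated_mgf (P n) (Y n) ((N n)%:R `^ alpha)
      (t * (N n)%:R `^ (alpha - 1)) ^+ N n <=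
    expR ((t ^+ 2 * sigma ^+ 2 / 2 + e) * (N n)%:R `^ (2 * alpha - 1))) ->
  forall y e, 0 < y -> 0 < e -> \forall n \near \oo,
    fine (P n [set w | (N n)%:R `^ alpha * y <= \sum_(i < N n) X n i w]) <=
    expR (- (y ^+ 2 / (2 * sigma ^+ 2) - e) * (N n)%:R `^ (2 * alpha - 1)).
Proof.
move=> roo iidX sigma0 q0 alpha2 alphae tail H y e y0 e0.
have near_r (A : R -> Prop) : (\forall x \near +oo, A x) ->
    \forall n \near \oo, A (N n)%:R by move=> HA; exact: roo HA.
have near_gt0 : \forall n \near \oo, 0 < (N n)%:R :> R.
  exact: (near_r (fun x => 0 < x) (nbhs_pinfty_gt (num_real 0))).
pose I := y ^+ 2 / (2 * sigma ^+ 2).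
(* The minimiser of t^2 sigma^2 / 2 - t y. *)
pose t := y / sigma ^+ 2.
have s20 : 0 < sigma ^+ 2 by rewrite exprn_gt0.
have t0 : 0 < t by rewrite divr_gt0.
have tI : t ^+ 2 * sigma ^+ 2 / 2 = I.
  by rewrite /t /I; field; rewrite gt_eqF.
have tyI : t * y = I + I by rewrite /t /I; field; rewrite gt_eqF.
have e20 : 0 < e / 2 by rewrite divr_gt0.
have Hm := H t (e / 2) t0 e20.
have v0 : 0 < 2 * alpha - 1 by lra.
(* This rewrites alpha (1 + eps) < 1: one large summand costs more than the Gaussian deviation. *)
have va : 2 * alpha - 1 < alpha * (1 - eps) by lra.
have q20 : 0 < q / 2 by rewrite divr_gt0.
have HV := near_r _ (near_pinfty_ge_powR _ (2 / e) v0).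
have Hln := near_r _ (near_pinfty_ln_le _ 1 _ (lt_trans v0 va) q20).
have HI := near_r _ (near_pinfty_powR_le _ _ I _ va q20).
near=> n.
have r0 : 0 < (N n)%:R :> R by near: n.
have iid : iid_copies (X n) (Y n) by near: n.
have : 2 / e <= (N n)%:R `^ (2 * alpha - 1) by near: n.
have : 1 * ln (N n)%:R <= q / 2 * (N n)%:R `^ (alpha * (1 - eps)) by near: n.
have : I * (N n)%:R `^ (2 * alpha - 1) <=
  q / 2 * (N n)%:R `^ (alpha * (1 - eps)) by near: n.
have : fine (P n [set w | (N n)%:R `^ alpha <= Y n w]) <=
     expR (- (q * (N n)%:R `^ (alpha * (1 - eps)))) by near: n.
have : truncated_mgf (P n) (Y n) ((N n)%:R `^ alpha)
      (t * (N n)%:R `^ (alpha - 1)) ^+ N n <=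
    expR ((t ^+ 2 * sigma ^+ 2 / 2 + e / 2) * (N n)%:R `^ (2 * alpha - 1)).
  by near: n.
set r : R := (N n)%:R; set V := r `^ (2 * alpha - 1).
move=> hm htail hI hln hV.
pose l := t * r `^ (alpha - 1).
have l0 : 0 <= l by rewrite mulr_ge0 ?powR_ge0// ltW.
have lV : l * (r `^ alpha * y) = (I + I) * V.
  rewrite -tyI /l /V.
  have -> : 2 * alpha - 1 = alpha - 1 + alpha by ring.
  by rewrite (@powRD _ r (alpha - 1) alpha) ?(gt_eqF r0) ?implybT// [RHS]mulrACA [y * _]mulrC.
have := sum_tail_le (P n) _ (X n) (Y n) (r `^ alpha) l (r `^ alpha * y) iid l0.
rewrite card_ord lV => /le_trans; apply.
(* Absorbs the factor 2 that comes from adding two terms of the same size. *)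
have V2 : 2 <= expR (e / 2 * V).
  apply: le_trans (expR_ge1Dx _).
  by move: hV; rewrite ler_pdivrMr//; clear; lra.
apply: (@le_trans _ _ (2 * expR (- (I - e / 2) * V))); last first.
  have -> : - (I - e) * V = e / 2 * V + - (I - e / 2) * V by field.
  by rewrite expRD ler_wpM2r// expR_ge0.
have -> : 2 * expR (- (I - e / 2) * V) =
  expR (- (I - e / 2) * V) + expR (- (I - e / 2) * V) by ring.
have V0 : 0 <= V by exact: powR_ge0.
apply: lerD.
  apply: (@le_trans _ _ (r * expR (- (q * r `^ (alpha * (1 - eps)))))).
    by rewrite ler_wpM2l ?(ltW r0).
  (* Half of q r^(alpha (1 - eps)) pays for r = exp(ln r), the other half exceeds I V. *)
  rewrite -[X in X * _](lnK (x := r)) ?posrE// -expRD ler_expR.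
  have : 0 <= e / 2 * V by rewrite mulr_ge0// ltW.
  by move: hln hI; clear; lra.
apply: (@le_trans _ _ (expR (- ((I + I) * V)) * expR ((I + e / 2) * V))).
  by rewrite ler_wpM2l ?expR_ge0// -tI.
by rewrite -expRD ler_expR le_eqVlt; apply/orP; left; apply/eqP; ring.
Unshelve. all: by end_near. Qed.

(** The tilt is aimed slightly above y, so that both ends of the window lie at a fixed distance from
    its centre and the mass outside is exponentially smaller. *)
Lemma sum_tail_lower {R : realType} (d : nat -> measure_display)
    (Omega : forall n : nat, measurableType (d n))
    (P : forall n : nat, probability (Omega n) R) (N : nat -> nat)
    (Y : forall n : nat, {RV (P n) >-> R})
    (X : forall n : nat, 'I_(N n) -> {RV (P n) >-> R})
    (sigma alpha : R) :
  (N n)%:R @[n --> \oo] --> (+oo : set_system R) ->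
  (\forall n \near \oo, iid_copies (X n) (Y n)) ->
  0 < sigma -> 1 / 2 < alpha ->
  (forall t e, 0 < t -> 0 < e -> \forall n \near \oo,
    expR ((t ^+ 2 * sigma ^+ 2 / 2 - e) * (N n)%:R `^ (2 * alpha - 1)) <=
    truncated_mgf (P n) (Y n) ((N n)%:R `^ alpha)
      (t * (N n)%:R `^ (alpha - 1)) ^+ N n <=
    expR ((t ^+ 2 * sigma ^+ 2 / 2 + e) * (N n)%:R `^ (2 * alpha - 1))) ->
  forall y e, 0 <= y -> 0 < e -> \forall n \near \oo,
    expR (- (y ^+ 2 / (2 * sigma ^+ 2) + e) * (N n)%:R `^ (2 * alpha - 1)) <=
    fine (P n [set w | (N n)%:R `^ alpha * y <= \sum_(i < N n) X n i w]).
Proof.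
move=> roo iidX sigma0 alpha2 H y e y0 e0.
have near_r (A : R -> Prop) : (\forall x \near +oo, A x) ->
    \forall n \near \oo, A (N n)%:R by move=> HA; exact: roo HA.
have near_gt0 : \forall n \near \oo, 0 < (N n)%:R :> R.
  exact: (near_r (fun x => 0 < x) (nbhs_pinfty_gt (num_real 0))).
have s20 : 0 < sigma ^+ 2 by rewrite exprn_gt0.
pose c := (sigma ^+ 2)^-1.
have c0 : 0 < c by rewrite invr_gt0.
have cs : sigma ^+ 2 = c^-1 by rewrite invrK.
have y20 : 0 < 2 * y + 2 by lra.
(* The final exponent exceeds y^2 c / 2 by 2 c D y + 7 c D^2 / 4, which is at most c D (2 y + 2) as
   D <= 1; this choice makes it at most [e]. *)
pose D := Num.min 1 (e / c / (2 * y + 2)).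
have D0 : 0 < D by rewrite lt_min ltr01 !divr_gt0.
have D1 : D <= 1 by rewrite ge_min lexx.
have De : c * (D * (2 * y + 2)) <= e.
  rewrite mulrC -ler_pdivlMr// -ler_pdivlMr//.
  by rewrite ge_min lexx orbT.
(* Tilting by t centres the sum at x r^alpha; the window is [y, x + D[. *)
pose x := y + D; pose t := x * c; pose m := D / 2 * c.
have x0 : 0 < x by rewrite ltr_wpDl.
have t0 : 0 < t by rewrite mulr_gt0.
have m0 : 0 < m by rewrite !mulr_gt0.
have mt : m < t by rewrite ltr_pM2r// /x; move: D0 y0; clear; lra.
(* With m = D c / 2, the exponents of the two discarded parts are B - 3 f, where B = t^2 sigma^2 /
   2. A tolerance [f] leaves them at B - 2 f, below the B - f of the main term. *)
pose f := D ^+ 2 * c / 8.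
have f0 : 0 < f by rewrite divr_gt0// mulr_gt0// exprn_gt0.
have Ht := H t f t0 f0.
have Htp := H (t + m) f (addr_gt0 t0 m0) f0.
have Htm := H (t - m) f ltac:(by rewrite subr_gt0) f0.
have v0 : 0 < 2 * alpha - 1 by lra.
have HV := near_r _ (near_pinfty_ge_powR _ (4 / f) v0).
near=> n.
have r0 : 0 < (N n)%:R :> R by near: n.
have iid : iid_copies (X n) (Y n) by near: n.
have : expR (((t - m) ^+ 2 * sigma ^+ 2 / 2 - f) *
      (N n)%:R `^ (2 * alpha - 1)) <=
    truncated_mgf (P n) (Y n) ((N n)%:R `^ alpha)
      ((t - m) * (N n)%:R `^ (alpha - 1)) ^+ N n <=
    expR (((t - m) ^+ 2 * sigma ^+ 2 / 2 + f) * (N n)%:R `^ (2 * alpha - 1)).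
  by near: n.
have : expR (((t + m) ^+ 2 * sigma ^+ 2 / 2 - f) *
      (N n)%:R `^ (2 * alpha - 1)) <=
    truncated_mgf (P n) (Y n) ((N n)%:R `^ alpha)
      ((t + m) * (N n)%:R `^ (alpha - 1)) ^+ N n <=
    expR (((t + m) ^+ 2 * sigma ^+ 2 / 2 + f) * (N n)%:R `^ (2 * alpha - 1)).
  by near: n.
have : expR ((t ^+ 2 * sigma ^+ 2 / 2 - f) *
      (N n)%:R `^ (2 * alpha - 1)) <=
    truncated_mgf (P n) (Y n) ((N n)%:R `^ alpha)
      (t * (N n)%:R `^ (alpha - 1)) ^+ N n <=
    expR ((t ^+ 2 * sigma ^+ 2 / 2 + f) * (N n)%:R `^ (2 * alpha - 1)).
  by near: n.
have : 4 / f <= (N n)%:R `^ (2 * alpha - 1) by near: n.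
set r : R := (N n)%:R; set V := r `^ (2 * alpha - 1).
move=> fV /andP[hl _] /andP[_ hp] /andP[_ hm].
have V0 : 0 <= V by exact: powR_ge0.
have Hlow := sum_tail_ge (P n) _ (X n) (Y n) (r `^ alpha) (t * r `^ (alpha - 1))
  (m * r `^ (alpha - 1)) (r `^ alpha * y) (r `^ alpha * (x + D)) iid.
have ar0 : 0 <= r `^ (alpha - 1) by exact: powR_ge0.
have {Hlow} := Hlow (mulr_ge0 (ltW m0) ar0) (ler_wpM2r ar0 (ltW mt)).
apply: le_trans; rewrite card_ord -mulrDl -mulrBl.
have VM k z : k * r `^ (alpha - 1) * (r `^ alpha * z) = k * z * V.
  rewrite /V; have -> : 2 * alpha - 1 = alpha - 1 + alpha by ring.
  rewrite (@powRD _ r (alpha - 1) alpha) ?(gt_eqF r0) ?implybT//.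
  by rewrite [RHS]mulrACA [z * _]mulrC.
rewrite !VM.
set Gl := _ ^+ N n in hl *; set Gp := _ ^+ N n in hp *; set Gm := _ ^+ N n in hm *.
pose B := t ^+ 2 * sigma ^+ 2 / 2.
have EB : B = x ^+ 2 * c / 2 by rewrite /B /t cs; field; rewrite gt_eqF.
have Ep : (t + m) ^+ 2 * sigma ^+ 2 / 2 + f = B + m * (x + D) - 2 * f.
  by rewrite EB /t /m /f cs; field; rewrite gt_eqF.
have Em : (t - m) ^+ 2 * sigma ^+ 2 / 2 + f = B - m * y - 2 * f.
  by rewrite EB /t /m /f cs /x; field; rewrite gt_eqF.
have H1 : expR (- (m * (x + D) * V)) * Gp <= expR ((B - 2 * f) * V).
  apply: (@le_trans _ _ (expR (- (m * (x + D) * V)) *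
      expR ((B + m * (x + D) - 2 * f) * V))).
    by rewrite ler_wpM2l ?expR_ge0// -Ep.
  by rewrite -expRD ler_expR; clear; lra.
have H2 : expR (m * y * V) * Gm <= expR ((B - 2 * f) * V).
  apply: (@le_trans _ _ (expR (m * y * V) * expR ((B - m * y - 2 * f) * V))).
    by rewrite ler_wpM2l ?expR_ge0// -Em.
  by rewrite -expRD ler_expR; clear; lra.
(* The main term is worth three units of exp((B - 2 f) V) and each discarded part at most one, so
   one unit survives. *)
have H3 : 3 * expR ((B - 2 * f) * V) <= expR ((B - f) * V).
  have -> : (B - f) * V = f * V + (B - 2 * f) * V by ring.
  rewrite expRD ler_wpM2r ?expR_ge0//; apply: le_trans (expR_ge1Dx _).
  by move: fV; rewrite ler_pdivrMr//; clear; lra.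
have H4 : expR ((B - 2 * f) * V) <= Gl -
    expR (- (m * (x + D) * V)) * Gp - expR (m * y * V) * Gm.
  by move: H1 H2 (le_trans H3 hl); clear; lra.
apply: (@le_trans _ _ (expR (- (t * (x + D) * V)) * expR ((B - 2 * f) * V))); last first.
  by rewrite ler_wpM2l ?expR_ge0.
rewrite -expRD ler_expR -mulNr -mulrDl ler_wpM2r//.
have -> : - (t * (x + D)) + (B - 2 * f) =
    - (y ^+ 2 * c / 2 + c * (D * (2 * y + 2)) - c * D * (1 - D) * 2 - c * D ^+ 2 / 4).
  by rewrite EB /t /f /x; field.
have -> : y ^+ 2 / (2 * sigma ^+ 2) = y ^+ 2 * c / 2.
  by rewrite cs; field; rewrite gt_eqF.
have : 0 <= c * D * (1 - D) by rewrite !mulr_ge0 ?subr_ge0// ltW.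
have : 0 <= c * D ^+ 2 by rewrite mulr_ge0 ?exprn_ge0// ltW.
by move: De; clear; lra.
Unshelve. all: by end_near. Qed.

(** * Passage between extended-real asymptotics and real inequalities *)

Lemma asymp_dominated_le1 {R : realType} (x y : nat -> R) :
  (\forall n \near \oo, `|x n / y n| <= 1) -> asymp_dominated x y.
Proof.
move=> xy; rewrite /asymp_dominated /limn_esup limf_esupE.
apply: (@le_lt_trans _ _ 1%E); last exact: ltry.
apply: ge_ereal_inf; exists (ereal_sup ((fun n => (`|x n / y n|)%:E) @`
   [set n | `|x n / y n| <= 1])); first by exists [set n | `|x n / y n| <= 1].
by apply: ge_ereal_sup => _ [n xyn <-]; rewrite lee_fin.
Qed.

(** The ratio eventually exceeds 1/2, and multiplying by the negative [b n] reverses the inequality.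
    Halving the rate is harmless: only the order of the exponent matters later. *)
Lemma asymp_equiv_lne_le {R : realType} (a : nat -> \bar R) (b : nat -> R) :
  (\forall n \near \oo, b n < 0) -> (forall n, a n \is a fin_num) ->
  asymp_equiv (fun n => lne (a n)) b ->
  \forall n \near \oo, fine (a n) <= expR (b n / 2).
Proof.
move=> b0 afin ab.
have h : 1 / 2 < 1 :> R by lra.
have := ab _ (@nbhs_open_ereal_gt _ 1 (fun=> 1 / 2) h).
rewrite nbhs_simpl /= => Hn; near=> n.
have bn : b n < 0 by near: n.
have : (((1 / 2 : R)%:E) < lne (a n) * ((b n)^-1)%:E)%E by near: n.
rewrite -(fineK (afin n)); set p := fine (a n) => H.
have [p0|p0] := leP p 0; first by rewrite (le_trans p0)// expR_ge0.
move: H; rewrite lne_EFin//= lte_fin ltr_ndivlMr// => H.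
by rewrite -[p]lnK ?posrE// ler_expR ltW//; move: H; clear; lra.
Unshelve. all: by end_near. Qed.

Lemma expectation_integrable {d} {T : measurableType d} {R : realType}
    (P : probability T R) (f : T -> R) :
  measurable_fun setT f -> (forall w, 0 <= f w) -> 'E_P[f]%E \is a fin_num ->
  P.-integrable setT (EFin \o f).
Proof.
move=> mf f0; rewrite unlock => fin; apply/integrableP; split.
  exact/measurable_EFinP.
under eq_integral do rewrite /= ger0_norm//.
by rewrite ltey_eq fin.
Qed.

(** The lower bound makes [p n] eventually positive, so its logarithm is finite and the limit can be
    taken among the reals. *)
Lemma lne_squeeze {R : realType} (p : nat -> \bar R) (V : nat -> R) (I : R) :
  (forall n, p n \is a fin_num) -> (\forall n \near \oo, 0 < V n) ->
  (forall e, 0 < e -> \forall n \near \oo,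
    expR (- (I + e) * V n) <= fine (p n) <= expR (- (I - e) * V n)) ->
  (((V n)^-1)%:E * lne (p n))%E @[n --> \oo] --> (- I)%:E.
Proof.
move=> pfin V0 H; apply/fine_cvgP; split.
  near=> n; have : expR (- (I + 1) * V n) <= fine (p n) <= expR (- (I - 1) * V n).
    by near: n; apply: H.
  move=> /andP[h _]; rewrite -(fineK (pfin n)) lne_EFin//.
  by apply: lt_le_trans h; exact: expR_gt0.
apply/cvgrPdist_le => e e0; near=> n.
have Vn : 0 < V n by near: n.
have : expR (- (I + e) * V n) <= fine (p n) <= expR (- (I - e) * V n).
  by near: n; apply: H.
move=> /andP[h1 h2].
have p0 : 0 < fine (p n) by apply: lt_le_trans h1; exact: expR_gt0.
rewrite /= -(fineK (pfin n)) lne_EFin//=.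
move: h1 h2; rewrite -[fine (p n)]lnK ?posrE// !ler_expR expRK.
rewrite -(ler_pdivrMr _ _ Vn) -(ler_pdivlMr _ _ Vn) [_^-1 * _]mulrC.
by rewrite ler_distl => h1 h2; apply/andP; split; move: h1 h2; clear; lra.
Unshelve. all: by end_near. Qed.

(** * The limit under hypotheses (i), (ii) and (iii) *)

Theorem theorem2 (R : realType)
  (d : nat -> measure_display)
  (Omega : forall n : nat, measurableType (d n))
  (P : forall n : nat, probability (Omega n) R)
  (N : nat -> nat)
  (Y : forall n : nat, {RV (P n) >-> R})
  (X : forall n : nat, 'I_(N n) -> {RV (P n) >-> R})
  (N_ge1 : forall n : nat, (1 <= n)%N -> (1 <= N n)%N)
  (N_infty : N @ \oo --> \oo)
  (Y_centered : forall n : nat, (1 <= n)%N -> centered (Y n))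
  (X_iid : forall n : nat, (1 <= n)%N -> iid_copies (X n) (Y n))
  (eps q sigma alpha : R)
  (eps_gt0 : 0 < eps) (eps_lt1 : eps < 1)
  (q_gt0 : 0 < q) (sigma_gt0 : 0 < sigma)
  (alpha_gt : 1 / 2 < alpha) (alpha_lt : alpha < (1 + eps)^-1)
  (tail_Y : forall y : nat -> R,
     (forall n : nat, (1 <= n)%N -> 0 < y n) ->
     asymp_dominated (fun n => (N n)%:R `^ (alpha * eps)) y ->
     asymp_dominated y (fun n => (N n)%:R `^ alpha) ->
     asymp_equiv (fun n => lne (P n [set w | y n <= Y n w]))
                 (fun n => - q * y n `^ (1 - eps)))
  (var_Y : 'E_(P n)[(fun w => (Y n w ^+ 2)%R)]%E @[n --> \oo] --> (sigma ^+ 2)%:E)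
  (moment_Y : exists gamma : R, 0 < gamma <= 1 /\
     asymp_negligible (fun n => 'E_(P n)[(fun w => (`|Y n w| `^ (2 + gamma))%R)]%E)
                      (fun n => (N n)%:R `^ (gamma * (1 - alpha)))) :
  forall y : R, 0 <= y ->
    ((((N n)%:R `^ (2 * alpha - 1))^-1)%R%:E *
      lne (P n [set w | ((N n)%:R `^ alpha * y <= \sum_(i < N n) X n i w)%R]))%E
      @[n --> \oo] --> (- (y ^+ 2 / (2 * sigma ^+ 2)))%:E.
Proof.
move=> y y0.
have roo : (N n)%:R @[n --> \oo] --> (+oo : set_system R) by apply/cvgrnyP.
have near1 : \forall n \near \oo, (1 <= n)%N by exact: nbhs_infty_ge.
have iidX : \forall n \near \oo, iid_copies (X n) (Y n).
  by apply: filterS near1 => n; exact: X_iid.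
have N1 n : (1 <= n)%N -> 1 <= (N n)%:R :> R.
  by move=> /N_ge1; rewrite ler1n.
have NgtO n : (1 <= n)%N -> 0 < (N n)%:R :> R.
  by move=> /N1; exact: lt_le_trans.
have eps1 : 0 < 1 + eps by rewrite addr_gt0.
have alphae : alpha * (1 + eps) < 1.
  by move: alpha_lt; rewrite -[_^-1]mul1r ltr_pdivlMr.
have alpha0 : 0 < alpha by lra.
have alpha1 : alpha < 1.
  by apply: le_lt_trans alphae; rewrite ler_peMr ?(ltW alpha0)// lerDl ltW.
have [g [/andP[g0 g1] moment]] := moment_Y.
have fin_P n A : measurable A -> P n A \is a fin_num by exact: fin_num_measure.
(* Hypothesis (i) is used only along pure powers y_n = N_n^s; both domination ratios are at most 1
   because N_n >= 1. *)
have tail s : alpha * eps <= s <= alpha -> \forall n \near \oo,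
    fine (P n [set w | (N n)%:R `^ s <= Y n w]) <=
    expR (- (q / 2 * (N n)%:R `^ (s * (1 - eps)))).
  move=> /andP[s1 s2].
  have le1 (a b : R) n : a <= b -> (1 <= n)%N ->
      `|(N n)%:R `^ a / (N n)%:R `^ b| <= 1 :> R.
    move=> ab n1; rewrite -powRB ?(gt_eqF (NgtO _ n1)) ?implybT//.
    rewrite ger0_norm ?powR_ge0// -[leRHS](powRr0 (N n)%:R).
    by apply: ler_powR; [exact: N1|rewrite subr_le0].
  have := tail_Y (fun n => (N n)%:R `^ s) _ _ _.
  move=> /(_ (fun n n1 => powR_gt0 _ (NgtO _ n1))).
  have d1 : asymp_dominated (fun n => (N n)%:R `^ (alpha * eps))
      (fun n => (N n)%:R `^ s : R).
    by apply: asymp_dominated_le1; apply: filterS near1 => n; exact: le1.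
  have d2 : asymp_dominated (fun n => (N n)%:R `^ s)
      (fun n => (N n)%:R `^ alpha : R).
    by apply: asymp_dominated_le1; apply: filterS near1 => n; exact: le1.
  move=> /(_ d1 d2) /asymp_equiv_lne_le H.
  have : \forall n \near \oo, fine (P n [set w | (N n)%:R `^ s <= Y n w]) <=
      expR (- q * ((N n)%:R `^ s) `^ (1 - eps) / 2).
    apply: H => [|n]; last first.
      by apply: fin_P; apply: measurable_RV_ge; exact: measurable_funPT.
    apply: filterS near1 => n n1.
    by rewrite mulNr oppr_lt0 mulr_gt0// powR_gt0// powR_gt0// NgtO.
  apply: filterS => n; rewrite -powRrM.
  by rewrite mulNr mulNr mulrAC.
have /fine_cvgP[var_fin var] := var_Y.
have /fine_cvgP[mom_fin mom] := moment.
have nearN : \forall n \near \oo, 0 < (N n)%:R `^ (g * (1 - alpha)) :> R.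
  by apply: filterS near1 => n n1; rewrite powR_gt0// NgtO.
have mY n : measurable_fun setT (Y n) by exact: measurable_funPT.
(* An infinite moment would stay infinite after division by the positive rate, against the
   finiteness of the ratio. *)
have mom_fin' : \forall n \near \oo,
    'E_(P n)[(fun w => (`|Y n w| `^ (2 + g))%R)]%E \is a fin_num.
  near=> n.
  have W0 : 0 < (N n)%:R `^ (g * (1 - alpha)) :> R by near: n.
  have : ('E_(P n)[(fun w => (`|Y n w| `^ (2 + g))%R)] *
     (((N n)%:R `^ (g * (1 - alpha)))^-1)%:E)%E \is a fin_num by near: n.
  have : (0 <= 'E_(P n)[(fun w => (`|Y n w| `^ (2 + g))%R)])%E.
    by apply: expectation_ge0 => w; exact: powR_ge0.
  case: ('E_(P n)[_])%E => // _.
  by rewrite gt0_mulye// lte_fin invr_gt0.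
have HY : \forall n \near \oo, [/\ (P n).-integrable setT (EFin \o Y n),
     \int[P n]_w Y n w = 0,
     (P n).-integrable setT (EFin \o (fun w => Y n w ^+ 2)) &
     (P n).-integrable setT (EFin \o (fun w => `|Y n w| `^ (2 + g)))].
  near=> n.
  have n1 : (1 <= n)%N by near: n.
  have [iY EY] := Y_centered n n1.
  split => //.
  - by rewrite /Rintegral -expectation_def EY.
  - apply: expectation_integrable => //; last by near: n.
    + by apply: measurable_funX.
    + by move=> w; exact: sqr_ge0.
  - apply: expectation_integrable => //; last by near: n.
    + apply: measurableT_comp (measurable_powR _) _.
      by apply: measurableT_comp.
have var' : \int[P n]_w (Y n w ^+ 2) @[n --> \oo] --> sigma ^+ 2.
  rewrite (_ : (fun n => _) = fine \o (fun n => 'E_(P n)[(fun w => (Y n w ^+ 2)%R)])%E)//.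
  by apply/funext => n; rewrite /= unlock.
have mom' : (\int[P n]_w (`|Y n w| `^ (2 + g))) / (N n)%:R `^ (g * (1 - alpha))
    @[n --> \oo] --> 0.
  apply: cvg_trans mom; apply: near_eq_cvg; near=> n.
  have : 'E_(P n)[(fun w => (`|Y n w| `^ (2 + g))%R)]%E \is a fin_num by near: n.
  by move=> /fineK /= E; rewrite -E /= /Rintegral unlock.
have g01 : 0 < g <= 1 by rewrite g0.
have asy := truncated_mgf_asymp _ _ _ _ _ _ _ _ _ _ roo eps_gt0 eps_lt1 q_gt0
  alpha_gt alphae g01 HY var' mom' tail.
have pow := truncated_mgf_exprn_asymp _ _ _ _ _ _ _ roo sigma_gt0 alpha1 asy.
have pow_ub t e : 0 < t -> 0 < e -> \forall n \near \oo,
    truncated_mgf (P n) (Y n) ((N n)%:R `^ alpha)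
      (t * (N n)%:R `^ (alpha - 1)) ^+ N n <=
    expR ((t ^+ 2 * sigma ^+ 2 / 2 + e) * (N n)%:R `^ (2 * alpha - 1)).
  by move=> t0 e0; apply: filterS (pow t e t0 e0) => n /andP[].
(* The halved rate from [tail], taken at s = alpha, is the rate used for the event of a large
   summand. *)
have q20 : 0 < q / 2 by rewrite divr_gt0.
have ae : alpha * eps <= alpha <= alpha.
  by rewrite lexx andbT ler_piMr ?(ltW alpha0)// ltW.
apply: lne_squeeze.
- move=> n; apply: fin_P; apply: measurable_RV_ge.
  by apply: measurable_sum => i; exact: measurable_funPT.
- by apply: filterS near1 => n n1; rewrite powR_gt0// NgtO.
move=> e e0.
have lo := sum_tail_lower _ _ _ _ _ _ _ _ roo iidX sigma_gt0 alpha_gt pow y e y0 e0.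
have up : \forall n \near \oo,
    fine (P n [set w | (N n)%:R `^ alpha * y <= \sum_(i < N n) X n i w]) <=
    expR (- (y ^+ 2 / (2 * sigma ^+ 2) - e) * (N n)%:R `^ (2 * alpha - 1)).
  (* For y = 0 the optimal tilt would be 0, outside the range of the estimates; there a probability
     is at most 1 <= exp(e V), with V = N^(2 alpha - 1). *)
  move: y0; rewrite le_eqVlt => /predU1P[<-|y0]; last first.
    exact: (sum_tail_upper _ _ _ _ _ _ _ _ _ _ roo iidX sigma_gt0 q20 alpha_gt
      alphae (tail _ ae) pow_ub y e y0 e0).
  apply: nearW => n; apply: (@le_trans _ _ 1).
    rewrite -lee_fin fineK; last first.
      apply: fin_P; apply: measurable_RV_ge.
      by apply: measurable_sum => i; exact: measurable_funPT.
    apply: probability_le1; apply: measurable_RV_ge.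
    by apply: measurable_sum => i; exact: measurable_funPT.
  rewrite -[leLHS]expR0 ler_expR mulr_ge0 ?powR_ge0//.
  by rewrite expr0n mul0r sub0r opprK ltW.
by near=> n; apply/andP; split; near: n.
Unshelve. all: by end_near. Qed.
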